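(* If a closeness space $X$ is totally bounded and pointed (i.e. an element of $X$ is given), then $X$ is uniformly continuously searchable.
   Context: We work in constructive Martin-Löf type theory; ''there is'' means an explicit witness. $\mathbb{N}_\infty$ is the type of decreasing binary sequences $u:\mathbb{N}\to\{0,1\}$; $\underline{n}$ is $n$ ones followed by zeros, $\infty$ the constant $1$ sequence; $u\preceq v$ iff $\forall n\,(u_n=1\Rightarrow v_n=1)$; $\min$ is pointwise. A closeness space is a type $X$ with $c:X\to X\to\mathbb{N}_\infty$ such that $c(x,y)=\infty\iff x=y$, $c(x,y)=c(y,x)$, and $\min(c(x,y),c(y,z))\preceq c(x,z)$. $C_\varepsilon(x,y)$ means $\underline{\varepsilon}\preceq c(x,y)$. A type is finite linearly ordered if it is equipped with an equivalence to $\{0,\dots,n-1\}$ for some $n\in\mathbb{N}$. An $\varepsilon$-net of $X$ is a finite linearly ordered type $X'$ with functions $g:X'\to X$ and $h:X\to X'$ such that $C_\varepsilon(x,g(h(x)))$ for all $x\in X$; $X$ is totally bounded if it has an $\varepsilon$-net for every $\varepsilon\in\mathbb{N}$. A predicate $p$ on $X$ is decidable if $p(x)$ or $\neg p(x)$ can be decided for every $x$, and uniformly continuous if there is $\delta\in\mathbb{N}$ with $C_\delta(x_1,x_2)\Rightarrow(p(x_1)\Leftrightarrow p(x_2))$. $X$ is uniformly continuously searchable if for every decidable predicate $p$ given with a modulus of uniform continuity there is $x_0\in X$ such that if some $x\in X$ satisfies $p$ then $p(x_0)$. *)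

(* Defs.v *)
From mathcomp Require Import all_boot.

Set Implicit Arguments.
Unset Strict Implicit.
Unset Printing Implicit Defensive.

(* Existential data (nets, moduli, decisions, the searched point) lives in
   [Type], as the mathematics asks for explicit witnesses; [Prop] is used
   for statements carrying no such data.  The premise [exists x, p x] of
   searchability is also in [Prop]; as the conclusion [p x0] is a proposition,
   this is equivalent to assuming an element of [{x | p x}]. *)

Record Ninf : Type := MkNinf {
  Ninf_seq :> nat -> bool;
  Ninf_decr : forall n, Ninf_seq n.+1 -> Ninf_seq n }.

Lemma Ninf_of_nat_decr (n k : nat) : k.+1 < n -> k < n.
Proof. exact: ltnW. Qed.

Definition Ninf_of_nat (n : nat) : Ninf := MkNinf (@Ninf_of_nat_decr n).

Definition infty : Ninf := @MkNinf (fun=> true) (fun _ _ => isT).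

Definition preceq (u v : Ninf) : Prop := forall n, u n = true -> v n = true.

Lemma min_decr (u v : Ninf) (n : nat) : u n.+1 && v n.+1 -> u n && v n.
Proof. by case/andP=> /Ninf_decr-> /Ninf_decr->. Qed.

Definition Ninf_min (u v : Ninf) : Ninf := MkNinf (@min_decr u v).

Record closeness_space : Type := MkClosenessSpace {
  cs_car :> Type;
  clos : cs_car -> cs_car -> Ninf;
  clos_infty : forall x y, clos x y = infty <-> x = y;
  clos_sym : forall x y, clos x y = clos y x;
  clos_ultra : forall x y z,
    preceq (Ninf_min (clos x y) (clos y z)) (clos x z) }.

Definition Cball (X : closeness_space) (eps : nat) (x y : X) : Prop :=
  preceq (Ninf_of_nat eps) (clos x y).

(* The library's [bijective] is a [Prop], from which the inverse cannot be
   extracted, so the inverse is given as a field. *)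
Record fin_lin_ordered (F : Type) : Type := MkFinLinOrdered {
  flo_card : nat;
  flo_to : F -> 'I_flo_card;
  flo_of : 'I_flo_card -> F;
  flo_toK : cancel flo_to flo_of;
  flo_ofK : cancel flo_of flo_to }.

Record net (X : closeness_space) (eps : nat) : Type := MkNet {
  net_car : Type;
  net_fin : fin_lin_ordered net_car;
  net_g : net_car -> X;
  net_h : X -> net_car;
  net_close : forall x : X, Cball eps x (net_g (net_h x)) }.

Definition totally_bounded (X : closeness_space) : Type :=
  forall eps : nat, net X eps.

Definition decidable_pred (X : Type) (p : X -> Prop) : Type :=
  forall x : X, {p x} + {~ p x}.

Definition modulus_of (X : closeness_space) (p : X -> Prop) (delta : nat)
    : Prop :=
  forall x1 x2 : X, Cball delta x1 x2 -> (p x1 <-> p x2).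

Definition unif_continuous_pred (X : closeness_space) (p : X -> Prop) : Type :=
  {delta : nat | modulus_of p delta}.

Definition uc_searchable (X : closeness_space) : Type :=
  forall p : X -> Prop, decidable_pred p -> unif_continuous_pred p ->
    {x0 : X | (exists x : X, p x) -> p x0}.

(* Main.v *)
From mathcomp Require Import all_boot.
Require Import Defs.

(* If [p] has modulus [delta] and holds at [x], then it holds at the point
   [g (h x)] of a [delta]-net, so it suffices to search the finitely many points
   of the net; the given point of [X] is the answer when none satisfies [p]. *)

Theorem theorem3p88 (X : closeness_space) (HX : totally_bounded X) (pt : X) :
  uc_searchable X.
Proof.
move=> p pdec [delta pmod].
case: (HX delta) => F [n to of_ toK _] g h gh_close.
(* The search runs over the indices ['I_n], a finite type, because [F] is a bare type in bijection
   with it; the decision [pdec] is coerced to a boolean test. *)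
case: (pickP (fun i : 'I_n => pdec (g (of_ i)) : bool)) => [i pi | p0].
  by exists (g (of_ i)) => _; case: (pdec _) pi.
exists pt => -[x px].
(* The failed search is contradicted at the index of [h x], the net element assigned to the witness
   [x]; [toK] removes the passage through ['I_n], leaving the test at [g (h x)]. *)
have := p0 (to (h x)); rewrite toK.
case: (pdec _) => // np _; case: np.
exact: (proj1 (pmod _ _ (gh_close x)) px).
Qed.
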